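(* Let $(S_t)_{t\ge0}$ be the Gamma process. The paths of $S_t$ are right-Lipschitz. That is, for every $a>0$ there is a (almost surely finite) random variable $K_a$, which is nonintegrable ($\mathbb{E}K_a=\infty$), such that almost surely $$0\le S_t-S_a\le K_a\,(t-a)\qquad\text{for all } t>a .$$
   Context: The Gamma process $(S_t)_{t\ge0}$ is the Lévy process with $S_0=0$, right-continuous paths with left limits, independent and stationary increments, and $S_t$ having the Gamma density $\frac{x^{t-1}}{\Gamma(t)}e^{-x}$, $x>0$, for $t>0$ (equivalently $\mathbb{E}e^{-\theta S_t}=(1+\theta)^{-t}$, $\theta>0$). *)

(* Defs.v *)
From HB Require Import structures.
From mathcomp Require Import all_boot all_order all_algebra.
From mathcomp Require Import all_classical all_reals all_analysis.

Set Implicit Arguments.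
Unset Strict Implicit.
Unset Printing Implicit Defensive.

Import Order.TTheory GRing.Theory Num.Theory.
Import numFieldNormedType.Exports.

Local Open Scope classical_set_scope.
Local Open Scope ring_scope.

Definition gamma_fun (R : realType) (t : R) : R :=
  \int[lebesgue_measure]_(x in `]0, +oo[) (x `^ (t - 1) * expR (- x)).

Definition gamma_pdf (R : realType) (t : R) : R -> R :=
  (fun x => x `^ (t - 1) / gamma_fun t * expR (- x)) \_ `]0, +oo[.

(* The product rule for subfamilies is the case where some [B i] is [setT]. *)
Definition mutually_independent (d : measure_display) (T : measurableType d)
    (R : realType) (P : probability T R) (I : finType)
    (X : I -> T -> R) : Prop :=
  forall B : I -> set R, (forall i, measurable (B i)) ->
    (P (\bigcap_(i in [set: I]) (X i @^-1` B i))
     = \prod_(i : I) P (X i @^-1` B i))%E.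

(* Paths indexed by [0, +oo[: the values at negative times are irrelevant. *)
Definition cadlag (R : realType) (f : R -> R) : Prop :=
  (forall t, 0 <= t -> f s @[s --> t^'+] --> f t) /\
  (forall t, 0 < t -> cvg (f s @[s --> t^'-])).

(* A process (S_t)_(t >= 0) is a family indexed by all of R of which only the
   members with t >= 0 are constrained. Laws are compared on Borel sets only,
   since a measure is unspecified on non-measurable
   sets. *)
Record levy_process (d : measure_display) (T : measurableType d)
    (R : realType) (P : probability T R) (S : R -> {RV P >-> R}) : Prop := {
  levy_start : {ae P, forall w, S 0 w = 0} ;
  levy_cadlag : {ae P, forall w, cadlag (fun t => S t w)} ;
  levy_independent : forall (n : nat) (t : nat -> R), 0 <= t 0%N ->
    (forall i, (i < n)%N -> t i < t i.+1) ->
    mutually_independent P (fun i : 'I_n => S (t i.+1) \- S (t i)) ;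
  levy_stationary : forall s h : R, 0 <= s -> 0 <= h ->
    forall B : set R, measurable B ->
      P ((S (s + h) \- S s) @^-1` B) = P (S h @^-1` B)
}.
Arguments levy_process {d T R} P S.

Record gamma_process (d : measure_display) (T : measurableType d)
    (R : realType) (P : probability T R) (S : R -> {RV P >-> R}) : Prop := {
  gamma_levy : levy_process P S ;
  gamma_density : forall t : R, 0 < t -> forall B : set R, measurable B ->
    distribution P (S t) B =
      (\int[lebesgue_measure]_(x in B) (gamma_pdf t x)%:E)%E
}.
Arguments gamma_process {d T R} P S.

(* Main.v *)
Require Import Defs.
From HB Require Import structures.
From mathcomp Require Import all_boot all_order all_algebra.
From mathcomp Require Import all_classical all_reals all_analysis.
From mathcomp Require Import measurable_realfun.
From mathcomp Require Import ring lra.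

Import Order.TTheory GRing.Theory Num.Theory.
Import numFieldNormedType.Exports.

Local Open Scope classical_set_scope.
Local Open Scope ring_scope.

(** Since increments are stationary, [X_u = S (a + u) - S a] has the Gamma law of
parameter [u], and almost surely the paths are nondecreasing. By monotonicity
it is enough to bound the slopes [(S (a + u) - S a) / u] along the geometric
grid [u = 4 ^ n], [n] in Z: a point [u] between two grid points only costs a
factor [4]. On each half of the grid the slopes are almost surely bounded by
the Borel-Cantelli lemma ([ae_bounded_seq]), because the Gamma law satisfies

- [P (X_u > u) <= C * sqrt u] for [u <= 1] ([gamma_tail_small]), summable along
  [u = 4 ^ - n]; here the absence of drift shows: for small [u] the mass of
  [X_u] sits far below [u], and [1 / Gamma(u)], which is of order [u], controls
  what is left;
- [P (X_u > 16 * u) <= 1 / u] for [u >= 1] ([gamma_tail_large]), summable along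
  [u = 4 ^ n]; this is a large deviation estimate for a mean equal to [u].

Neither estimate evaluates the Gamma function. The density has total mass [1],
so integrating a lower bound of the density over a well chosen interval bounds
[1 / Gamma(u)] from above ([inv_gamma_fun_le], [inv_gamma_fun_powR_le]).

The two suprema [M1] and [M2] thus give a finite Lipschitz constant
[4 * (M1 + M2)]. Any larger random variable is again a Lipschitz constant, and
nonintegrability is obtained by adding [exp (2 * |S 1|)]: as [S 1] is standard
exponential, this has infinite expectation ([expectation_exp_infinite]). *)

(** * Tails of the Gamma law *)

Section GammaDensity.
Context {R : realType}.
Local Notation mu := (@lebesgue_measure R).
Implicit Types t x : R.

Lemma within_continuous_inv (u v : R) : 0 < u ->
  {within `[u, v], continuous (fun x : R => x^-1)}.
Proof.
move=> u0; apply: continuous_in_subspaceT => x.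
rewrite inE/= in_itv/= => /andP[ux _].
by apply: inv_continuous; rewrite gt_eqF// (lt_le_trans u0).
Qed.

Lemma measurable_inv (u v : R) : 0 < u ->
  measurable_fun `[u, v] (EFin \o (fun x : R => x^-1)).
Proof.
move=> u0; apply/measurable_EFinP.
apply: (@subspace_continuous_measurable_fun R `[u, v]) => //.
exact: within_continuous_inv.
Qed.

Lemma integral_inv (u v : R) : 0 < u -> u <= v ->
  (\int[mu]_(x in `[u, v]) (x^-1)%:E = (ln v - ln u)%:E)%E.
Proof.
move=> u0; rewrite le_eqVlt => /predU1P[<-|uv].
  by rewrite set_itv1 integral_set1 subrr.
have pos x : u <= x -> 0 < x by exact: lt_le_trans.
have dln x : u <= x -> derivable (@ln R) x 1.
  by move=> ux; apply: ex_derive; exact: (is_derive1_ln (pos _ ux)).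
rewrite (continuous_FTC2 (F := @ln R)) ?EFinB//.
- exact: within_continuous_inv.
- split.
  + move=> x; rewrite in_itv/= => /andP[ux _]; exact/dln/ltW.
  + by apply: cvg_at_right_filter; exact: continuous_ln.
  + by apply: cvg_at_left_filter; apply: continuous_ln; exact/pos/ltW.
- move=> x; rewrite in_itv/= => /andP[ux _].
  by rewrite derive1E; have [_ ->] := is_derive1_ln (pos x (ltW ux)).
Qed.

Lemma integral_expR_tail_le (r b : R) : 0 < r -> 0 <= b ->
  (\int[mu]_(x in `]b, +oo[) (expR (- r * x))%:E <= (r^-1)%:E)%E.
Proof.
move=> r0 b0.
have mf (D : set R) : measurable_fun D (EFin \o exponential_pdf r).
  by apply: measurable_funTS; apply/measurable_EFinP; exact: measurable_exponential_pdf.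
have -> : (\int[mu]_(x in `]b, +oo[) (expR (- r * x))%:E =
    \int[mu]_(x in `]b, +oo[) ((r^-1)%:E * (exponential_pdf r x)%:E))%E.
  apply: eq_integral => x; rewrite inE/= in_itv/= andbT => bx.
  by rewrite exponential_pdfE ?(le_trans b0 (ltW bx))// -EFinM mulKf// gt_eqF.
have pdf0 x : (0 <= (exponential_pdf r x)%:E)%E.
  by rewrite lee_fin exponential_pdf_ge0// ltW.
rewrite ge0_integralZl_EFin ?invr_ge0 ?(ltW r0)//; last exact: mf.
rewrite -[leRHS]mule1; apply: lee_wpmul2l; first by rewrite lee_fin invr_ge0 ltW.
rewrite -(integral_exponential_pdf r0); apply: ge0_subset_integral => //; exact: mf.
Qed.

Lemma gamma_fun_ge0 t : 0 <= gamma_fun t.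
Proof.
by apply: Rintegral_ge0 => x _; rewrite mulr_ge0 ?powR_ge0 ?expR_ge0.
Qed.

Lemma gamma_pdfE t x : 0 < x ->
  gamma_pdf t x = x `^ (t - 1) / gamma_fun t * expR (- x).
Proof. by move=> x0; rewrite /gamma_pdf patchE ifT// inE/= in_itv/= x0. Qed.

Lemma gamma_pdf_le0 t x : x <= 0 -> gamma_pdf t x = 0.
Proof.
move=> x0; rewrite /gamma_pdf patchE ifF//; apply/negP.
by rewrite inE/= in_itv/= andbT ltNge x0.
Qed.

Lemma gamma_pdf_ge0 t x : 0 <= gamma_pdf t x.
Proof.
have [x0|x0] := leP x 0; first by rewrite gamma_pdf_le0.
by rewrite gamma_pdfE// !mulr_ge0 ?powR_ge0 ?expR_ge0 ?invr_ge0 ?gamma_fun_ge0.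
Qed.

Lemma measurable_gamma_pdf t (D : set R) :
  measurable_fun D (EFin \o gamma_pdf t).
Proof.
apply: measurable_funTS; apply/measurable_EFinP/measurable_restrict => //.
apply: measurable_funTS; apply: measurable_funM.
  by apply: measurable_funM => //; exact: measurable_powR.
by apply: measurableT_comp => //; exact: measurable_funN.
Qed.

(** The only information on the Gamma function that the estimates below use. *)
Definition gamma_mass1 t := (\int[mu]_x (gamma_pdf t x)%:E = 1)%E.

Lemma integral_gamma_pdf_le1 t D : measurable D -> gamma_mass1 t ->
  (\int[mu]_(x in D) (gamma_pdf t x)%:E <= 1)%E.
Proof.
move=> mD <-; apply: ge0_subset_integral => //.
- exact: measurable_gamma_pdf.
- by move=> x _; rewrite lee_fin gamma_pdf_ge0.
Qed.

(** A Gamma integral that diverged, or vanished, would have value [0], hence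
the density would be identically [0], against its total mass. *)
Lemma gamma_fun_gt0 t : gamma_mass1 t -> 0 < gamma_fun t.
Proof.
move=> t1; rewrite lt_neqAle gamma_fun_ge0 andbT eq_sym; apply/eqP => g0.
have : (\int[mu]_x (gamma_pdf t x)%:E = 0)%E.
  apply: integral0_eq => x _; have [x0|x0] := leP x 0.
    by rewrite gamma_pdf_le0.
  by rewrite gamma_pdfE// g0 invr0 mulr0 mul0r.
by rewrite t1 => /eqP; rewrite onee_eq0.
Qed.

(** On [[exp (- 1 / t), 1]], whose logarithmic length is [1 / t], the factor
[x `^ t] is at least [exp (- 1)], so that the density is at least
[exp (- 2) * x^-1 / Gamma(t)]. *)
Lemma inv_gamma_fun_le t : 0 < t -> gamma_mass1 t ->
  (gamma_fun t)^-1 <= expR 2 * t.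
Proof.
move=> t0 t1; have c0 := gamma_fun_gt0 t t1.
set c := (gamma_fun t)^-1.
have c_ge0 : 0 <= c by rewrite invr_ge0 ltW.
(* chosen so that [u `^ t = exp (- 1)] and [- ln u = 1 / t] *)
pose u := expR (- t^-1).
have u0 : 0 < u by exact: expR_gt0.
have u1 : u <= 1 by rewrite expR_le1 oppr_le0 invr_ge0 ltW.
have : ((c * expR (-2))%:E * \int[mu]_(x in `[u, 1%R]) (x^-1)%:E <= 1)%E.
  rewrite -ge0_integralZl_EFin//.
  - apply: le_trans (integral_gamma_pdf_le1 t `[u, 1] _ t1) => //.
    apply: ge0_le_integral => //.
    + move=> x; rewrite /= in_itv/= => /andP[ux _].
      by rewrite -EFinM lee_fin !mulr_ge0 ?c_ge0 ?expR_ge0//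
        invr_ge0 (le_trans (ltW u0)).
    + by apply: emeasurable_funM => //; exact: measurable_inv.
    + exact: measurable_gamma_pdf.
    + move=> x; rewrite /= in_itv/= => /andP[ux x1].
      have x0 : 0 < x by exact: lt_le_trans ux.
      rewrite -EFinM lee_fin gamma_pdfE// -/c.
      rewrite powRB ?(gt_eqF x0) ?implybT// powRr1 ?(ltW x0)//.
      have -> : (-2 : R) = -1 + -1 by lra.
      rewrite expRD.
      have h1 : expR (- 1) <= x `^ t.
        rewrite -(@mulVf _ t) ?gt_eqF// -mulNr expRM.
        by apply: ge0_ler_powR; rewrite ?nnegrE ?expR_ge0 ?(ltW t0) ?(ltW x0).
      have h2 : expR (- 1) <= expR (- x) by rewrite ler_expR lerN2.
      rewrite (_ : x `^ t / x * c * expR (- x) =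
        c * (x `^ t * expR (- x)) / x); last by ring.
      rewrite ler_wpM2r ?invr_ge0 ?(ltW x0)// ler_wpM2l// ler_pM ?expR_ge0//.
  - move=> x; rewrite /= in_itv/= => /andP[ux _].
    by rewrite lee_fin invr_ge0 (le_trans (ltW u0)).
  - exact: measurable_inv.
  - by rewrite mulr_ge0 ?expR_ge0.
rewrite integral_inv// ln1 sub0r /u expRK opprK -EFinM lee_fin.
by rewrite ler_pdivrMr// mul1r expRN ler_pdivrMr ?expR_gt0// mulrC.
Qed.

(** A weak form of Stirling's lower bound: on [[t, 2 * t]], of length [t], the
density is at least [t `^ (t - 1) * exp (- 2 * t) / Gamma(t)]. *)
Lemma inv_gamma_fun_powR_le t : 1 <= t -> gamma_mass1 t ->
  (gamma_fun t)^-1 * t `^ t * expR (- (2 * t)) <= 1.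
Proof.
move=> t1 m1; have c0 := gamma_fun_gt0 t m1.
have t0 : 0 < t by exact: lt_le_trans t1.
set c := (gamma_fun t)^-1.
have c_ge0 : 0 <= c by rewrite invr_ge0 ltW.
have := integral_gamma_pdf_le1 t `[t, 2 * t] (measurable_itv _) m1.
set k := c * t `^ (t - 1) * expR (- (2 * t)).
have : (\int[mu]_(x in `[t, (2 * t)%R]) (cst k%:E) x <=
        \int[mu]_(x in `[t, (2 * t)%R]) (gamma_pdf t x)%:E)%E.
  apply: ge0_le_integral => //.
  - by move=> x _; rewrite /= lee_fin !mulr_ge0 ?powR_ge0 ?expR_ge0.
  - exact: measurable_gamma_pdf.
  - move=> x; rewrite /= in_itv/= => /andP[tx x2].
    have x0 : 0 < x by exact: lt_le_trans tx.
    rewrite lee_fin gamma_pdfE// -/c /k [c * _]mulrC.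
    rewrite ler_pM ?mulr_ge0 ?powR_ge0 ?expR_ge0//; last by rewrite ler_expR lerN2.
    by rewrite ler_wpM2r// ge0_ler_powR ?nnegrE ?(ltW t0) ?(ltW x0) ?subr_ge0.
move=> /le_trans/[apply]; rewrite integral_cst//= lebesgue_measure_itv/= lte_fin.
rewrite ifT; last by lra.
rewrite -EFinB -EFinM lee_fin; apply: le_trans; rewrite le_eqVlt; apply/orP; left.
rewrite -[in X in X == _](mulr_powRB1 (ltW t0) t0) /k; apply/eqP; ring.
Qed.

(** Up to the factor [1 / Gamma(t)], which is [O(t)], the density is below [x^-1]
on [[t, 1]] and below [exp (- x)] beyond [1]. The mass is therefore
[O(t * (1 - ln t))], and the logarithm is absorbed by [sqrt t]. *)
Lemma gamma_tail_small t : 0 < t -> t <= 1 -> gamma_mass1 t ->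
  (\int[mu]_(x in `]t, +oo[) (gamma_pdf t x)%:E
    <= (3 * expR 2 * Num.sqrt t)%:E)%E.
Proof.
move=> t0 t1 m1; have c0 := gamma_fun_gt0 t m1.
have cle := inv_gamma_fun_le t t0 m1.
set c := (gamma_fun t)^-1 in cle.
have c_ge0 : 0 <= c by rewrite invr_ge0 ltW.
(* [ln y < y] at [y = (sqrt t)^-1] *)
have lnt : - ln t <= 2 / Num.sqrt t.
  have s0 : 0 < Num.sqrt t by rewrite sqrtr_gt0.
  have : 0 < (Num.sqrt t)^-1 by rewrite invr_gt0.
  move=> /ln_sublinear.
  rewrite lnV ?posrE// => h.
  have -> : ln t = ln (Num.sqrt t) *+ 2 by rewrite -lnXn// sqr_sqrtr// ltW.
  by rewrite mulr2n; lra.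
have -> : `]t, +oo[%classic = `]t, 1] `|` `]1, +oo[ :> set R.
  rewrite -itv_bndbnd_setU//= bnd_simp//.
rewrite ge0_integral_setU//; last 3 first.
- exact: measurable_gamma_pdf.
- by move=> x _; rewrite lee_fin gamma_pdf_ge0.
- apply/disj_setPS => x [/=]; rewrite !in_itv/= andbT => /andP[_ x1].
  by rewrite ltNge x1.
have b1 : (\int[mu]_(x in `]t, 1%R]) (gamma_pdf t x)%:E <= (c * (- ln t))%:E)%E.
  have <- : (\int[mu]_(x in `[t, 1%R]) (c%:E * (x^-1)%:E) = (c * (- ln t))%:E)%E.
    rewrite ge0_integralZl_EFin//.
    - by rewrite integral_inv// ln1 sub0r EFinM.
    - move=> x; rewrite /= in_itv/= => /andP[tx _].
      by rewrite lee_fin invr_ge0 (le_trans (ltW t0)).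
    - exact: measurable_inv.
  apply: (@le_trans _ _ (\int[mu]_(x in `[t, 1%R]) (gamma_pdf t x)%:E)%E).
    apply: ge0_subset_integral => //.
    - exact: measurable_gamma_pdf.
    - by move=> x _; rewrite lee_fin gamma_pdf_ge0.
    - exact: subset_itv_oc_cc.
  apply: ge0_le_integral => //.
  - by move=> x _; rewrite lee_fin gamma_pdf_ge0.
  - exact: measurable_gamma_pdf.
  - apply: emeasurable_funM => //.
    exact: measurable_inv.
  - move=> x; rewrite /= in_itv/= => /andP[tx x1].
    have x0 : 0 < x by exact: lt_le_trans tx.
    rewrite -EFinM lee_fin gamma_pdfE// -/c.
    rewrite powRB ?(gt_eqF x0) ?implybT// powRr1 ?(ltW x0)//.
    rewrite -[leRHS]mulr1 ler_pM ?mulr_ge0 ?powR_ge0 ?c_ge0 ?invr_ge0 ?expR_ge0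
      ?(ltW x0)//.
      rewrite mulrC ler_wpM2l// -[leRHS]mul1r ler_wpM2r ?invr_ge0 ?(ltW x0)//.
      by rewrite -(powRr0 x) ger_powR ?x0// ltW.
    by rewrite expR_le1 oppr_le0 ltW.
have b2 : (\int[mu]_(x in `]1%R, +oo[) (gamma_pdf t x)%:E <= c%:E)%E.
  have mE : measurable_fun setT (EFin \o (fun x : R => expR (- 1 * x))).
    by apply/measurable_EFinP/measurableT_comp => //; exact: measurable_funM.
  apply: (@le_trans _ _ (\int[mu]_(x in `]1%R, +oo[) (c%:E * (expR (- 1 * x))%:E))%E).
    apply: ge0_le_integral => //.
    - by move=> x _; rewrite lee_fin gamma_pdf_ge0.
    - exact: measurable_gamma_pdf.
    - by apply: emeasurable_funM => //; exact: measurable_funTS.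
    - move=> x; rewrite /= in_itv/= andbT => x1.
      have x0 : 0 < x by exact: lt_trans x1.
      rewrite -EFinM lee_fin gamma_pdfE// -/c mulN1r ler_wpM2r ?expR_ge0//.
      rewrite -[leRHS]mul1r ler_wpM2r// -[leRHS](powRr0 x) ler_powR ?(ltW x1)//; lra.
  rewrite ge0_integralZl_EFin//.
  - rewrite -[leRHS]mule1 lee_wpmul2l// -[X in (_ <= X%:E)%E]invr1.
    exact: integral_expR_tail_le.
  - exact: measurable_funTS.
apply: le_trans (leeD b1 b2) _; rewrite -EFinD lee_fin.
have s0 : 0 < Num.sqrt t by rewrite sqrtr_gt0.
have s1 : Num.sqrt t <= 1 by rewrite -sqrtr1 ler_sqrt.
have ts : t = Num.sqrt t * Num.sqrt t by rewrite -expr2 sqr_sqrtr// ltW.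
have e0 : 0 < expR 2 :> R by exact: expR_gt0.
apply: (@le_trans _ _ (expR 2 * t * (2 / Num.sqrt t + 1))).
  rewrite -[X in _ + X]mulr1 -mulrDr ler_pM//.
    by rewrite addr_ge0// oppr_ge0 ln_le0.
  by rewrite lerD2r.
rewrite [3 * _]mulrC -!mulrA ler_wpM2l ?(ltW e0)// mulrDr mulr1.
rewrite {1}ts mulrCA -mulrA mulfV ?gt_eqF// mulr1.
nra.
Qed.

(** Exponential bound: [x `^ t <= (4 * t) `^ t * exp (x / 4)] trades the power for
an exponential, and beyond [16 * t] what is left of [exp (- x)] beats the
normalisation [(4 * t) `^ t / Gamma(t) <= exp (4 * t)]. *)
Lemma gamma_tail_large t : 1 <= t -> gamma_mass1 t ->
  (\int[mu]_(x in `](16 * t)%R, +oo[) (gamma_pdf t x)%:E <= (t^-1)%:E)%E.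
Proof.
move=> t1 m1; have c0 := gamma_fun_gt0 t m1.
have t0 : 0 < t by exact: lt_le_trans t1.
have cle := inv_gamma_fun_powR_le t t1 m1.
set c := (gamma_fun t)^-1 in cle.
have c_ge0 : 0 <= c by rewrite invr_ge0 ltW.
set k := c * (4 * t) `^ t * expR (- (8 * t)).
have k0 : 0 <= k by rewrite !mulr_ge0 ?powR_ge0 ?expR_ge0.
have mE : measurable_fun setT (EFin \o (fun x : R => expR (- 4^-1 * x))).
  by apply/measurable_EFinP/measurableT_comp => //; exact: measurable_funM.
apply: (@le_trans _ _
   (\int[mu]_(x in `](16 * t)%R, +oo[) (k%:E * (expR (- 4^-1 * x))%:E))%E).
  apply: ge0_le_integral => //.
  - by move=> x _; rewrite lee_fin gamma_pdf_ge0.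
  - exact: measurable_gamma_pdf.
  - by apply: emeasurable_funM => //; exact: measurable_funTS.
  - move=> x; rewrite /= in_itv/= andbT => x1.
    have x0 : 0 < x by lra.
    rewrite -EFinM lee_fin gamma_pdfE// -/c.
    (* [y <= exp y] at [y = x / (4 * t)], raised to the power [t] *)
    have h1 : x `^ (t - 1) <= (4 * t) `^ t * expR (x / 4).
      apply: (@le_trans _ _ (x `^ t)); first by apply: ler_powR; lra.
      have -> : x / 4 = (x / (4 * t)) * t.
        by field; rewrite gt_eqF.
      rewrite expRM -powRM ?expR_ge0//; last by lra.
      apply: ge0_ler_powR; rewrite ?nnegrE ?(ltW t0) ?(ltW x0)//.
        by rewrite mulr_ge0 ?expR_ge0//; lra.
      have -> : x = 4 * t * (x / (4 * t)) by field; rewrite gt_eqF.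
      rewrite ler_wpM2l//; first lra.
      rewrite [in leRHS](_ : 4 * t * (x / (4 * t)) = x); last by field; rewrite gt_eqF.
      by apply: le_trans (expR_ge1Dx _); rewrite lerDr.
    apply: (@le_trans _ _ (((4 * t) `^ t * expR (x / 4)) * c * expR (- x))).
      by rewrite ler_wpM2r ?expR_ge0// ler_wpM2r.
    rewrite /k (_ : _ * _ * _ * _ =
      c * (4 * t) `^ t * (expR (x / 4) * expR (- x))); last by ring.
    rewrite -[leRHS]mulrA ler_wpM2l ?mulr_ge0 ?powR_ge0//.
    by rewrite -!expRD ler_expR; lra.
rewrite ge0_integralZl_EFin//; last exact: measurable_funTS.
apply: (@le_trans _ _ (k%:E * 4%:E)%E).
  rewrite lee_wpmul2l// -[X in (_ <= X%:E)%E](invrK 4).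
  by apply: integral_expR_tail_le; lra.
rewrite -EFinM lee_fin /k powRM//; last exact: ltW.
have e1 : 2 <= expR 1 :> R by have := expR_ge1Dx (1 : R); lra.
have h4 : (4 : R) `^ t <= expR (2 * t).
  rewrite expRM; apply: ge0_ler_powR; rewrite ?nnegrE ?expR_ge0 ?(ltW t0)//.
  by rewrite (_ : 2 = 1 + 1 :> R) ?expRD; [nra|lra].
have h : c * (4 `^ t * t `^ t) * expR (- (8 * t)) <= expR (- (4 * t)).
  rewrite (_ : - (8 * t) = - (2 * t) + (- (4 * t) - 2 * t)); last by ring.
  rewrite !expRD.
  rewrite (_ : _ * _ = (c * t `^ t * expR (- (2 * t))) *
     (4 `^ t * expR (- (2 * t))) * expR (- (4 * t))); last by ring.
  rewrite -[leRHS]mul1r ler_wpM2r ?expR_ge0//.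
  rewrite -[leRHS]mulr1 ler_pM ?mulr_ge0 ?powR_ge0 ?expR_ge0//.
  by rewrite expRN ler_pdivrMr ?expR_gt0// mul1r.
apply: (@le_trans _ _ (expR (- (4 * t)) * 4)); first by rewrite ler_wpM2r.
rewrite expRN mulrC ler_pdivrMr ?expR_gt0// mulrC ler_pdivlMr//.
by apply: le_trans (expR_ge1Dx _); lra.
Qed.

End GammaDensity.

(** * Almost sure boundedness *)

Section AlmostSureBounds.
Context {d : measure_display} {T : measurableType d} {R : realType}.
Variable P : probability T R.
Implicit Types X : nat -> T -> R.

Lemma eventually_le_bounded (u : nat -> R) (b : R) (N : nat) :
  (forall n, (N <= n)%N -> u n <= b) -> exists B, forall n, u n <= B.
Proof.
move=> ub; exists (`|b| + \sum_(i < N) `|u i|) => n.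
have s0 : 0 <= \sum_(i < N) `|u i| by apply: sumr_ge0.
have [nN|Nn] := ltnP n N.
  rewrite (le_trans (ler_norm _))// (bigD1 (Ordinal nN))//= addrCA lerDl.
  by rewrite addr_ge0// sumr_ge0.
by rewrite (le_trans (ub _ Nn))// (le_trans (ler_norm b))// lerDl.
Qed.

(** Borel-Cantelli: almost surely only finitely many terms exceed [b]. The supremum
is taken in the extended reals, where it is always measurable, and only then
made real. *)
Lemma ae_bounded_seq X (b C : R) :
  (forall n, measurable_fun setT (X n)) ->
  (forall n, P [set w | (b < X n w)%R] <= (C * (2^-1) ^+ n)%:E)%E ->
  exists M : T -> R, [/\ measurable_fun setT M, forall w, 0 <= M w &
    {ae P, forall w, forall n, X n w <= M w}].
Proof.
move=> mX PX; pose E w := esups (fun n => (X n w)%:E) 0.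
exists (fun w => `|fine (E w)|); split => //.
  apply: measurableT_comp => //; apply: measurableT_comp => //.
  by apply: measurable_fun_esups => n; apply/measurable_EFinP.
pose A n := [set w | b < X n w].
have mA n : measurable (A n).
  rewrite (_ : A n = X n @^-1` `]b, +oo[).
    by rewrite -[_ @^-1` _]setTI; exact: mX.
  by apply/seteqP; split => w; rewrite /A/= in_itv/= andbT.
have mL : measurable (lim_sup_set A).
  apply: bigcapT_measurable => // n; exact: bigcup_measurable.
have L0 : P (lim_sup_set A) = 0%E.
  apply: lim_sup_set_cvg0 => //.
  pose v : nat -> R := geometric C 2^-1.
  have C0 : 0 <= C.
    by have := le_trans (measure_ge0 P _) (PX 0%N); rewrite lee_fin expr0 mulr1.
  apply: (@le_lt_trans _ _ (\sum_(n <oo) (v n)%:E)%E).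
    by apply: lee_nneseries => [n _ _|n _]; [exact: measure_ge0|exact: PX].
  have h : `|2^-1| < 1 :> R by rewrite gtr0_norm ?invr_gt0// invf_lt1// ltr1n.
  have /cvg_ex[/= l vl] := @is_cvg_geometric_series R C _ h.
  rewrite (_ : (\sum_(n <oo) (v n)%:E)%E = l%:E) ?ltry//.
  apply/cvg_lim => //; rewrite (_ : (fun n => _) = EFin \o series v).
    by apply: cvg_EFin => //; exact: nearW.
  by apply/funext => n; rewrite /= /series/= sumEFin.
exists (lim_sup_set A); split => // w /= nle.
apply: contrapT => nL; apply: nle.
have [N Nb] : exists N, forall n, (N <= n)%N -> X n w <= b.
  apply: contrapT => nN; apply: nL => N _.
  apply: contrapT => nE; apply: nN; exists N => n Nn.
  by rewrite leNgt; apply/negP => bX; apply: nE; exists n.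
have [B XB] := eventually_le_bounded _ _ _ Nb.
move=> n; apply: le_trans (ler_norm _).
have XE m : ((X m w)%:E <= E w)%E by apply: ereal_sup_ubound; exists m.
have EB : (E w <= B%:E)%E.
  by apply: ge_ereal_sup => _ [m _ <-]; rewrite lee_fin XB.
have Efin : E w \is a fin_num.
  by rewrite fin_numE gt_eqF ?lt_eqF ?(le_lt_trans EB) ?ltry//
    (lt_le_trans _ (XE 0%N))// ltNyr.
by rewrite -lee_fin fineK.
Qed.

End AlmostSureBounds.

(** * Monotone paths *)

(** Lets one pass from countably many times, which almost sure statements can
handle, to all times. *)
Lemma right_continuous_rat_le {R : realType} (f : R -> R) (t r y : R) :
  f s @[s --> t^'+] --> f t -> t < r ->
  (forall q : rat, t < ratr q < r -> y <= f (ratr q)) -> y <= f t.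
Proof.
move=> cf tr yf; rewrite leNgt; apply/negP => fy.
have : \forall s \near t^'+, f s < y /\ s < r.
  near=> s; split; last by near: s; exact: nbhs_right_lt.
  by near: s; exact: (cvgr_lt (f t)).
move=> [e /= e0 fe].
have /rat_in_itvoo[q] : t < t + e by rewrite ltrDl.
rewrite in_itv/= => /andP[tq qe].
have [|fq qr] := fe (ratr q) _ tq.
  by rewrite /= distrC gtr0_norm ?subr_gt0// ltrBlDl.
by move: fq; rewrite ltNge yf// tq.
Unshelve. all: by end_near. Qed.

Section GammaProcess.
Context {d : measure_display} {T : measurableType d} {R : realType}.
Variables (P : probability T R) (S : R -> {RV P >-> R}).
Hypothesis hS : gamma_process P S.

Lemma increment_law (s h : R) (B : set R) : 0 <= s -> 0 < h -> measurable B ->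
  (P ((fun w => S (s + h) w - S s w)%R @^-1` B) =
   \int[lebesgue_measure]_(x in B) (gamma_pdf h x)%:E)%E.
Proof.
move=> s0 h0 mB; rewrite -(gamma_density hS)//.
exact: (levy_stationary (gamma_levy hS) s0 (ltW h0) mB).
Qed.

Lemma process_gamma_mass1 (t : R) : 0 < t -> gamma_mass1 t.
Proof.
move=> t0; rewrite /gamma_mass1 -(gamma_density hS)//.
exact: probability_setT.
Qed.

(** The increment has a density that vanishes on the negative half-line. *)
Lemma increment_ge0 (s t : R) : 0 <= s -> s <= t ->
  {ae P, forall w, S s w <= S t w}.
Proof.
move=> s0; rewrite le_eqVlt => /predU1P[->|st]; first exact: aeW.
have h0 : 0 < t - s by rewrite subr_gt0.
have mB : measurable (`]-oo, 0[ : set R) by [].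
have := increment_law s (t - s) _ s0 h0 mB.
rewrite subrKC integral0_eq => [P0|x]; last first.
  by rewrite /= in_itv/= => x0; rewrite gamma_pdf_le0// ltW.
exists ((fun w => S t w - S s w) @^-1` `]-oo, 0[); split => //.
  by rewrite -[_ @^-1` _]setTI; exact: measurable_funB.
by move=> w /= /negP; rewrite -ltNge in_itv/= subr_lt0.
Qed.

Lemma ae_increasing_paths :
  {ae P, forall w, forall s t, 0 <= s -> s <= t -> S s w <= S t w}.
Proof.
have rat_mono : {ae P, forall w, forall p q : rat, 0 <= p -> p <= q ->
    S (ratr p) w <= S (ratr q) w}.
  (* pairs of rationals are enumerated, so that [ae_foralln] applies *)
  have : {ae P, forall w, forall n, if unpickle n is Some (p, q) then
      0 <= p :> rat -> p <= q :> rat -> S (ratr p) w <= S (ratr q) w else True}.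
    apply/ae_foralln => n; case: unpickle => [[p q]|]; last exact: aeW.
    have [p0|p0] := leP 0 p; last exact: aeW.
    have [pq|pq] := leP p q; last exact: aeW.
    apply: filterS (increment_ge0 (ratr p) (ratr q) _ _) => //.
    - by rewrite ler0q.
    - by rewrite ler_rat.
  by apply: filterS => w H p q; have := H (pickle (p, q)); rewrite pickleK.
(* right-continuity is used twice, at [t] for rationals decreasing to [t] and
   then at [s] *)
apply: filterS2 (levy_cadlag (gamma_levy hS)) rat_mono => w [rc _] mono s t s0.
rewrite le_eqVlt => /predU1P[->//|st].
apply: (right_continuous_rat_le (fun t => S t w) t (t + 1)).
- by apply: rc; rewrite (le_trans s0)// ltW.
- by rewrite ltrDl.
(* the inequality at [s] is reversed, so the argument runs on [- S] *)
move=> q /andP[tq _]; rewrite -lerN2.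
apply: (right_continuous_rat_le (fun t => - S t w) s t) => //.
  by apply: cvgN; exact: rc.
move=> p /andP[sp pt]; rewrite lerN2; apply: mono.
- by rewrite -(@ler0q R) ltW// (le_lt_trans s0).
- by rewrite -(@ler_rat R) ltW// (lt_trans pt).
Qed.

End GammaProcess.

(** * Slopes along a geometric grid *)

Section Slopes.
Context {d : measure_display} {T : measurableType d} {R : realType}.
Variables (P : probability T R) (S : R -> {RV P >-> R}).
Hypothesis hS : gamma_process P S.
Variable a : R.
Hypothesis a0 : 0 <= a.

Definition slope (u : R) (w : T) : R := (S (a + u) w - S a w) / u.

Lemma measurable_slope u : measurable_fun setT (slope u).
Proof. by apply: measurable_funM => //; exact: measurable_funB. Qed.

Lemma slope_tail (u b : R) : 0 < u ->
  (P [set w | (b < slope u w)%R] =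
   \int[lebesgue_measure]_(x in `](b * u)%R, +oo[) (gamma_pdf u x)%:E)%E.
Proof.
move=> u0; rewrite -(increment_law P S hS a)//; congr (P _).
by apply/seteqP; split => w; rewrite /slope /= in_itv/= andbT ltr_pdivlMr.
Qed.

Lemma ae_bounded_slopes_large : exists M : T -> R,
  [/\ measurable_fun setT M, forall w, 0 <= M w &
    {ae P, forall w, forall n, slope (4 ^+ n) w <= M w}].
Proof.
apply: (ae_bounded_seq P _ 16 1) => n; first exact: measurable_slope.
have u1 : 1 <= 4 ^+ n :> R by rewrite exprn_ege1// ler1n.
have u0 : 0 < 4 ^+ n :> R by exact: lt_le_trans u1.
rewrite slope_tail//; apply: (le_trans (gamma_tail_large _ u1 _)).
  exact: (process_gamma_mass1 P S hS).
by rewrite lee_fin mul1r -exprVn lerXn2r ?nnegrE//; lra.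
Qed.

Lemma ae_bounded_slopes_small : exists M : T -> R,
  [/\ measurable_fun setT M, forall w, 0 <= M w &
    {ae P, forall w, forall n, slope (4 ^- n) w <= M w}].
Proof.
apply: (ae_bounded_seq P _ 1 (3 * expR 2)) => n; first exact: measurable_slope.
have u1 : 4 ^- n <= 1 :> R by rewrite invf_le1 ?exprn_gt0// exprn_ege1// ler1n.
have u0 : 0 < 4 ^- n :> R by rewrite invr_gt0 exprn_gt0.
rewrite slope_tail// mul1r; apply: (le_trans (gamma_tail_small _ u0 u1 _)).
  exact: (process_gamma_mass1 P S hS).
rewrite lee_fin ler_wpM2l ?mulr_ge0 ?expR_ge0//.
rewrite (_ : 4 ^- n = ((2^-1) ^+ n) ^+ 2) ?sqrtr_sqr; last first.
  rewrite -exprM mulnC exprM -exprVn; congr (_ ^+ n); lra.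
by rewrite ger0_norm ?exprn_ge0// invr_ge0.
Qed.

End Slopes.

(** * A nonintegrable function of the process *)

Section Nonintegrable.
Context {d : measure_display} {T : measurableType d} {R : realType}.
Variables (P : probability T R) (S : R -> {RV P >-> R}).
Hypothesis hS : gamma_process P S.

(** Markov's inequality gives [exp (2 * n) * P (|S 1| >= n)] as a lower bound for
every [n], and the probability is of order [exp (- n)]: the constant [2] makes
these bounds unbounded. *)
Lemma expectation_exp_infinite : ('E_P[fun w => expR (2 * `|S 1 w|)%R] = +oo)%E.
Proof.
have m1 : gamma_mass1 (1 : R) by apply: (process_gamma_mass1 P S hS).
have c0 := gamma_fun_gt0 _ m1.
set c := (gamma_fun (1 : R))^-1.
have cp : 0 < c by rewrite invr_gt0.
have lower (n : nat) : (0 < n)%N ->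
    ((c * n%:R)%:E <= 'E_P[fun w => expR (2 * `|S 1 w|)%R])%E.
  move=> n0; have n0' : 0 < n%:R :> R by rewrite ltr0n.
  have mE : measurable_fun setT (fun x : R => expR (2 * x)).
    by apply: measurableT_comp => //; exact: measurable_funM.
  have mono : {in Num.nneg &, {homo (fun x : R => expR (2 * x)) : x y / x <= y}}.
    by move=> x y _ _ xy; rewrite ler_expR ler_pM2l.
  apply: le_trans (markov (S 1) n0' mE (fun r _ => expR_ge0 _) mono).
  apply: (@le_trans _ _ ((expR (2 * n%:R))%:E *
     \int[lebesgue_measure]_(x in `[n%:R, (n%:R + 1)%R]) (gamma_pdf 1 x)%:E)%E).
    apply: (@le_trans _ _ ((expR (2 * n%:R))%:E * (c * expR (- (n%:R + 1)))%:E)%E).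
      rewrite -EFinM lee_fin mulrCA -expRD ler_pM2l//.
      by apply: le_trans (expR_ge1Dx _); lra.
    rewrite lee_wpmul2l ?lee_fin ?expR_ge0//.
    have <- : (\int[lebesgue_measure]_(x in `[n%:R, (n%:R + 1)%R])
        (cst (c * expR (- (n%:R + 1)))%:E) x = (c * expR (- (n%:R + 1)))%:E)%E.
      rewrite integral_cst//= lebesgue_measure_itv/= lte_fin ifT; last lra.
      by rewrite -EFinB -EFinM addrAC subrr add0r mulr1.
    apply: ge0_le_integral => //.
    - by move=> x _; rewrite /= lee_fin mulr_ge0 ?expR_ge0// ltW.
    - exact: measurable_gamma_pdf.
    - move=> x; rewrite /= in_itv/= => /andP[nx xn].
      have x0 : 0 < x by exact: lt_le_trans nx.
      rewrite lee_fin gamma_pdfE// subrr powRr0 mul1r -/c.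
      by rewrite ler_wpM2l ?(ltW cp)// ler_expR lerN2.
  rewrite lee_wpmul2l ?lee_fin ?expR_ge0//.
  rewrite -(gamma_density hS)// /distribution/= /pushforward.
  apply: le_measure; rewrite ?inE.
  - by rewrite -[_ @^-1` _]setTI; exact: measurable_funP.
  - rewrite [X in measurable X](_ : _ = (fun w => `|S 1 w|) @^-1` `[n%:R, +oo[).
      rewrite -[_ @^-1` _]setTI.
      have mS : measurable_fun setT (fun w => `|S 1 w|) by exact: measurableT_comp.
      exact: mS.
    by apply/seteqP; split => w; rewrite /= in_itv/= andbT lee_fin.
  - move=> w /=; rewrite in_itv/= => /andP[nx _].
    by rewrite lee_fin (le_trans nx)// ler_norm.
apply: eq_infty => r.
pose n := (Num.truncn (`|r| / c)).+1.
apply: le_trans (lower n _) => //; rewrite lee_fin (le_trans (ler_norm r))//.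
by rewrite mulrC -ler_pdivrMr// ltW// truncnS_gt.
Qed.

End Nonintegrable.

(** * Right-Lipschitz paths *)

Lemma exists_pow4_le {R : realType} (u : R) : 1 <= u ->
  exists n, 4 ^+ n <= u < 4 ^+ n.+1.
Proof.
move=> u1.
have ex : exists m, u < 4 ^+ m.
  exists (Num.truncn u).+1; apply: (lt_le_trans (Num.Theory.truncnS_gt u)).
  by rewrite -natrX ler_nat ltnW// ltn_expl.
case: (ex_minnP ex) => -[|n] un minn; first by move: un; rewrite expr0 ltNge u1.
exists n; rewrite un andbT leNgt; apply/negP => /minn.
by rewrite ltnn.
Qed.

Theorem theorem2p1 (d : measure_display) (T : measurableType d) (R : realType)
    (P : probability T R) (S : R -> {RV P >-> R}) (hS : gamma_process P S)
    (a : R) (ha : 0 < a) :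
  exists K : {RV P >-> R},
    ('E_P[K] = +oo)%E /\
    {ae P, forall w, forall t : R, a < t -> 0 <= S t w - S a w <= K w * (t - a)}.
Proof.
have [M1 [mM1 M1_0 aeM1]] := ae_bounded_slopes_large P S hS a (ltW ha).
have [M2 [mM2 M2_0 aeM2]] := ae_bounded_slopes_small P S hS a (ltW ha).
pose Z w := expR (2 * `|S 1 w|).
have mZ : measurable_fun setT Z.
  apply: measurableT_comp => //; apply: measurable_funM => //.
  exact: measurableT_comp.
pose k w := 4 * (M1 w + M2 w) + Z w.
have mk : measurable_fun setT k.
  by apply: measurable_funD => //; apply: measurable_funM => //; exact: measurable_funD.
have k_ge w : 4 * (M1 w + M2 w) <= k w by rewrite lerDl expR_ge0.
pose K : {RV P >-> R} := HB.pack k (isMeasurableFun.Build _ _ _ _ k mk).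
exists K; split.
  apply/eqP; rewrite -leye_eq -(expectation_exp_infinite P S hS).
  apply: expectation_le => //.
  - by move=> w; apply: le_trans (k_ge w); rewrite mulr_ge0 ?addr_ge0.
  - by apply: aeW => w; rewrite /= /k lerDr mulr_ge0 ?addr_ge0.
apply: filterS3 (ae_increasing_paths P S hS) aeM1 aeM2 => w mono b1 b2 t at_.
have u0 : 0 < t - a by rewrite subr_gt0.
rewrite subr_ge0 mono ?(ltW ha) ?(ltW at_)//=.
(* [v] is the grid point just above [t - a] and [M] bounds the slope there *)
have grid v M : 0 < v -> slope P S a v w <= M -> t - a <= v -> v <= 4 * (t - a) ->
    0 <= M -> S t w - S a w <= 4 * M * (t - a).
  move=> v0; rewrite /slope ler_pdivrMr// => sM tv v4 M0.
  have t0 : 0 <= t by rewrite (le_trans (ltW ha))// ltW.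
  have : S t w <= S (a + v) w by apply: mono => //; lra.
  nra.
apply: (@le_trans _ _ (4 * (M1 w + M2 w) * (t - a))); last first.
  by rewrite ler_wpM2r// ltW.
have M1w := M1_0 w; have M2w := M2_0 w.
have [u1|u1] := leP 1 (t - a).
  have [n /andP[nu un]] := exists_pow4_le _ u1.
  apply: (@le_trans _ _ (4 * M1 w * (t - a))); last by nra.
  apply: (grid (4 ^+ n.+1)) => //; first exact: ltW.
  by rewrite exprS ler_pM2l.
have [n /andP[nu un]] : exists n, 4 ^+ n <= (t - a)^-1 < 4 ^+ n.+1.
  by apply: exists_pow4_le; rewrite invf_ge1// ltW.
apply: (@le_trans _ _ (4 * M2 w * (t - a))); last by nra.
have p0 : 0 < 4 ^+ n :> R by rewrite exprn_gt0.
apply: (grid (4 ^- n)) => //.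
  by rewrite -[leLHS]invrK lef_pV2 ?posrE// invr_gt0.
rewrite -[leLHS]mul1r ler_pdivrMr// -mulrA mulrCA -exprS.
by rewrite mulrC -ler_pdivrMr// mul1r ltW.
Qed.
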